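(* Let $\sigma>0$, $\alpha>0$, $\Lambda = \frac{1}{\sigma}\sqrt{\Gamma(3/\alpha)/\Gamma(1/\alpha)}$, and let $Z$ be a real random variable with density $f_Z(z) = \frac{\alpha \Lambda^2}{\Gamma(1/\alpha)^2} K_0\!\left(2\Lambda^\alpha |z|^{\alpha/2}\right)$. Then for every $s$ with $\operatorname{Re} s > 0$, the Mellin transform of the density of $|Z|$ (equivalently, $\mathbb{E}\bigl[|Z|^{s-1}\bigr]$) is $$\int_0^\infty z^{s-1}\, 2 f_Z(z)\, dz = \mathbb{E}\bigl[|Z|^{s-1}\bigr] = \frac{\Lambda^{2-2s}}{\Gamma(1/\alpha)^2}\,\Gamma\!\left(\frac{s}{\alpha}\right)^2 .$$
   Context: $K_0$ is the modified Bessel function of the second kind of order $0$; $\Gamma$ is the Euler Gamma function. This $f_Z$ is the density of the product of two independent generalized normal $GND(0,\sigma,\alpha)$ variables (density $\frac{\alpha\Lambda}{2\Gamma(1/\alpha)} e^{-\Lambda^\alpha |x|^\alpha}$). The density of $|Z|$ is $2f_Z(z)$ for $z>0$. *)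

(* Defs.v *)
From HB Require Import structures.
From mathcomp Require Import all_boot all_order all_algebra.
From mathcomp Require Import all_classical all_reals all_analysis.
From mathcomp Require Import complex.
Set Implicit Arguments. Unset Strict Implicit. Unset Printing Implicit Defensive.
Import Order.TTheory GRing.Theory Num.Theory.
Import numFieldNormedType.Exports.
Local Open Scope classical_set_scope.
Local Open Scope ring_scope.
Local Open Scope complex_scope.

Section Defs.
Variable R : realType.

(* x^w for a real x > 0 and complex exponent w:
   x^w = exp (w ln x) = x^(complex.Re w) (cos (complex.Im w ln x) + i sin (complex.Im w ln x)). *)
Definition cpowR (x : R) (w : R[i]) : R[i] :=
  (x `^ complex.Re w)%:C * (cos (complex.Im w * ln x) +i* sin (complex.Im w * ln x)).

Definition cint0oo (f : R -> R[i]) : R[i] :=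
  (Rintegral lebesgue_measure `]0, +oo[ (fun t => complex.Re (f t)))
  +i* (Rintegral lebesgue_measure `]0, +oo[ (fun t => complex.Im (f t))).

Definition GammaR (x : R) : R :=
  Rintegral lebesgue_measure `]0, +oo[ (fun t => t `^ (x - 1) * expR (- t)).

Definition GammaC (w : R[i]) : R[i] :=
  cint0oo (fun t => cpowR t (w - 1) * (expR (- t))%:C).

Definition besselK0 (x : R) : R :=
  Rintegral lebesgue_measure `[0, +oo[
    (fun t => expR (- (x * ((expR t + expR (- t)) / 2)))).

Definition GND_Lambda (sigma alpha : R) : R :=
  sigma^-1 * Num.sqrt (GammaR (3 / alpha) / GammaR (1 / alpha)).

(* density of the product Z of two independent GND(0,sigma,alpha) variables *)
Definition fZ (sigma alpha : R) (z : R) : R :=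
  let L := GND_Lambda sigma alpha in
  alpha * L ^+ 2 / GammaR (1 / alpha) ^+ 2
  * besselK0 (2 * L `^ alpha * `|z| `^ (alpha / 2)).

End Defs.

(* Main.v *)
Require Import Defs.
From HB Require Import structures.
From mathcomp Require Import all_boot all_order all_algebra.
From mathcomp Require Import all_classical all_reals all_analysis.
From mathcomp Require Import complex.
From mathcomp Require Import ring lra measurable_realfun.
Import Order.TTheory GRing.Theory Num.Theory.
Import numFieldNormedType.Exports.
Local Open Scope classical_set_scope.
Local Open Scope ring_scope.
Local Open Scope complex_scope.

(* In the variable [t = e^x], [Gamma w] is the integral over the real line of
   [e^(w x) exp (- e^x)]. Squaring, and substituting first [v = x + y] and then
   [y = v / 2 + t], turns the double integral of
   [e^(w (x + y)) exp (- e^x - e^y)] into that of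
   [e^(w v) exp (- 2 e^(v/2) cosh t)], so that [Gamma w ^ 2] is the integral of
   [e^(w v) 2 K_0 (2 e^(v/2))]. With [w = s / alpha], the substitution
   [e^v = Lambda^(2 alpha) z^alpha] identifies it with the Mellin transform of
   [f_Z] up to the constant factor. *)

(** * Changes of variable: the exponential and affine maps *)

Lemma derive1_expR {R : realType} : (@expR R)^`()%classic = expR.
Proof. by apply/funext => x; rewrite derive1E derive_val. Qed.

(** Substitution is applied on the segments [[e^(-n), e^n]] and [[-n, n]], which correspond under
    [expR] and exhaust the half line and the line. As the integrands are nonnegative, monotone
    convergence passes to the limit on both sides. *)
Lemma ge0_integral_expR {R : realType} (G : R -> R) :
  {in `]0, +oo[, continuous G} -> (forall x, 0 < x -> 0 <= G x) ->
  (\int[lebesgue_measure]_(z in `]0%R, +oo[) (G z)%:E =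
   \int[lebesgue_measure]_x (G (expR x) * expR x)%:E)%E.
Proof.
move=> cG G0.
set mu := lebesgue_measure.
have mG : measurable_fun (`]0, +oo[ : set R) G.
  apply: open_continuous_measurable_fun; first exact: interval_open.
  by move=> x /[1!inE]; exact: cG.
have cGe : continuous (fun x : R => G (expR x) * expR x).
  move=> x; apply: continuousM; last exact: continuous_expR.
  apply: continuous_comp; first exact: continuous_expR.
  by apply: cG; rewrite in_itv/= expR_gt0.
pose A (n : nat) : set R := `[expR (- n%:R), expR n%:R]%classic.
pose B (n : nat) : set R := `[- n%:R, n%:R]%classic.
have UA : \bigcup_n A n = `]0, +oo[%classic.
  apply/seteqP; split=> [x [n _]|x]; rewrite /A/= !in_itv/= ?andbT.
    by move=> /andP[+ _]; apply: lt_le_trans; exact: expR_gt0.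
  move=> x0; have [n xn] : exists n : nat, `|ln x| <= n%:R.
    by exists (Num.truncn `|ln x|).+1; exact/ltW/truncnS_gt.
  exists n => //=; rewrite in_itv/= -{1 2}[x]lnK ?posrE// !ler_expR.
  by rewrite -ler_norml.
have UB : \bigcup_n B n = setT.
  apply/seteqP; split=> // x _; exists (Num.truncn `|x|).+1 => //=.
  by rewrite /B/= in_itv/= -ler_norml; exact/ltW/truncnS_gt.
have cA : (\int[mu]_(x in A n) (G x)%:E @[n --> \oo]
           --> \int[mu]_(x in `]0%R, +oo[) (G x)%:E)%E.
  rewrite -UA; apply: ge0_nondecreasing_set_cvg_integral => //.
  - move=> m n mn; apply/subsetPset; apply: subset_itv;
      by rewrite bnd_simp ler_expR ?lerN2 ler_nat.
  - by move=> i; exact: measurable_itv.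
  - by move=> i; apply/measurable_EFinP; apply: measurable_funS mG => //;
      rewrite -UA; exact: bigcup_sup.
  - move=> i x; rewrite /A/= in_itv/= lee_fin => /andP[ix _].
    by apply: G0; exact: lt_le_trans (expR_gt0 _) ix.
have cB : (\int[mu]_(x in B n) (G (expR x) * expR x)%:E @[n --> \oo]
           --> \int[mu]_x (G (expR x) * expR x)%:E)%E.
  rewrite -UB; apply: ge0_nondecreasing_set_cvg_integral => //.
  - by move=> m n mn; apply/subsetPset; apply: subset_itv;
      rewrite bnd_simp ?lerN2 ler_nat.
  - by move=> i; exact: measurable_itv.
  - move=> i; apply/measurable_funTS/measurable_EFinP.
    exact: continuous_measurable_fun.
  - by move=> i x _; rewrite lee_fin mulr_ge0// ?expR_ge0// G0// expR_gt0.
have AB : (fun n => \int[mu]_(x in A n) (G x)%:E)%E =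
          (fun n => \int[mu]_(x in B n) (G (expR x) * expR x)%:E)%E.
  apply/funext => n; rewrite /A /B.
  rewrite (@integration_by_substitution_increasing _ expR G (- n%:R) n%:R).
  - by rewrite derive1_expR.
  - by rewrite (@le_trans _ _ 0)// oppr_le0.
  - by move=> x y _ _; rewrite ltr_expR.
  - by rewrite derive1_expR => x _; exact: continuous_expR.
  - rewrite derive1_expR; apply: cvgP; apply: cvg_at_right_filter.
    exact: continuous_expR.
  - rewrite derive1_expR; apply: cvgP; apply: cvg_at_left_filter.
    exact: continuous_expR.
  - split => //.
    + by apply: cvg_at_right_filter; exact: continuous_expR.
    + by apply: cvg_at_left_filter; exact: continuous_expR.
  - apply: continuous_in_subspaceT => x; rewrite inE/= in_itv/= => /andP[nx _].
    by apply: cG; rewrite in_itv/= andbT (lt_le_trans _ nx)// expR_gt0.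
rewrite AB in cA; exact: cvg_unique cA cB.
Qed.

Lemma funepos_EFin {R : realType} {T : Type} (g : T -> R) :
  ((EFin \o g)^\+)%E = (fun x => (Num.max (g x) 0)%:E).
Proof. by apply/funext => x; rewrite funeposE EFin_max. Qed.

Lemma funeneg_EFin {R : realType} {T : Type} (g : T -> R) :
  ((EFin \o g)^\-)%E = (fun x => (Num.max (- g x) 0)%:E).
Proof. by apply/funext => x; rewrite funenegE EFin_max. Qed.

(** The positive and negative parts are treated separately; the Jacobian [expR x] is nonnegative, so
    it commutes with taking them. As an equality of extended reals, the identity also transports
    finiteness when applied to an absolute value. *)
Lemma integral_expR {R : realType} (G : R -> R) :
  {in `]0, +oo[, continuous G} ->
  (\int[lebesgue_measure]_(z in `]0%R, +oo[) (G z)%:E =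
   \int[lebesgue_measure]_x (G (expR x) * expR x)%:E)%E.
Proof.
move=> cG; rewrite integralE [RHS]integralE !funepos_EFin !funeneg_EFin.
rewrite (ge0_integral_expR (fun x => Num.max (G x) 0)); first last.
- by move=> x _; rewrite le_max lexx orbT.
- move=> x x0; apply: (@continuous_max R R G (cst 0)); first exact: cG.
  exact: cst_continuous.
rewrite (ge0_integral_expR (fun x => Num.max (- G x) 0)); first last.
- by move=> x _; rewrite le_max lexx orbT.
- move=> x x0; apply: (@continuous_max R R (- G) (cst 0)).
    by apply: continuousN; exact: cG.
  exact: cst_continuous.
congr (_ - _)%E; apply: eq_integral => x _;
  by rewrite maxr_pMl ?mul0r ?mulNr// expR_ge0.
Qed.

Lemma integral_affine {R : realType} (k c : R) (G : R -> R) :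
  0 < k -> continuous G ->
  (\int[lebesgue_measure]_z (G z)%:E =
   \int[lebesgue_measure]_x (G (k * x + c) * k)%:E)%E.
Proof.
move=> k0 cG.
have dE : (fun x => k * x + c)^`()%classic = cst k.
  by apply/funext => x; rewrite derive1E derive_val /GRing.scale/= mulr1 addr0.
have cgy (F : R -> R) : continuous F -> (forall x, 0 <= F x) ->
  (\int[lebesgue_measure]_z (F z)%:E =
   \int[lebesgue_measure]_x (F (k * x + c) * k)%:E)%E.
  move=> cF F0; rewrite (@increasing_ge0_integration_by_substitutionT _
    (fun x => k * x + c) F)//.
  - by under eq_integral do rewrite /= dE.
  - by move=> x y xy; rewrite ltrD2r ltr_pM2l.
  - by rewrite dE; exact: cst_continuous.
  - by rewrite dE; exact: is_cvg_cst.
  - by rewrite dE; exact: is_cvg_cst.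
  - apply/cvgrNyPle => A.
    (* The threshold solves [k * x + c = A]. *)
    apply: filterS (nbhs_ninfty_le (num_real (k^-1 * (A - c)))) => x.
    by rewrite ler_pdivlMl// lerBrDr.
  - apply/cvgryPge => A.
    apply: filterS (nbhs_pinfty_ge (num_real (k^-1 * (A - c)))) => x.
    by rewrite ler_pdivrMl// lerBlDr.
rewrite integralE [RHS]integralE !funepos_EFin !funeneg_EFin.
rewrite (cgy (fun x => Num.max (G x) 0)); first last.
- by move=> x; rewrite le_max lexx orbT.
- move=> x; apply: (@continuous_max R R G (cst 0)); first exact: cG.
  exact: cst_continuous.
rewrite (cgy (fun x => Num.max (- G x) 0)); first last.
- by move=> x; rewrite le_max lexx orbT.
- move=> x; apply: (@continuous_max R R (- G) (cst 0)).
    by apply: continuousN; exact: cG.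
  exact: cst_continuous.
congr (_ - _)%E; apply: eq_integral => x _;
  by rewrite maxr_pMl ?mul0r ?mulNr// ltW.
Qed.

(** * Exponential decay and integrability of the Gamma integrand *)

Lemma measurable_EFin_continuous {R : realType} (f : R -> R) :
  continuous f ->
  measurable_fun [set: measurableTypeR R] (fun x => (f x)%:E).
Proof.
by move=> cf; apply/measurable_EFinP; exact: continuous_measurable_fun.
Qed.

(** By evenness the integral is twice that over the half line, where [- c^-1 * expR (- (c * x))] is
    a primitive with limit 0 at infinity. *)
Lemma integral_expRN_norm_lty {R : realType} (c : R) : 0 < c ->
  (\int[lebesgue_measure]_x (expR (- (c * `|x|)))%:E < +oo)%E.
Proof.
move=> c0.
have cE : continuous (fun x : R => expR (- (c * `|x|))).
  move=> x; apply: continuous_comp; last exact: continuous_expR.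
  apply: continuousN; apply: continuousM; first exact: cst_continuous.
  exact: norm_continuous.
rewrite (ge0_symfun_integralT _ cE) //=; last first.
- by move=> x /=; rewrite normrN.
rewrite lte_mul_pinfty ?lee_fin//.
rewrite -set_itvcy.
under eq_integral.
  move=> x; rewrite inE/= in_itv/= andbT => x0; rewrite ger0_norm//.
  over.
rewrite (@ge0_continuous_FTC2y _ _ (fun x => - c^-1 * expR (- (c * x))) 0 0).
- by rewrite ltry.
- by move=> x _; exact: expR_ge0.
- apply: continuous_subspaceT => x.
  apply: continuous_comp; last exact: continuous_expR.
  apply: continuousN; apply: continuousM; first exact: cst_continuous.
  exact: cvg_id.
- rewrite -(mulr0 (- c^-1)); apply: cvgM; first exact: cvg_cst.
  apply: (@cvg_comp _ _ _ (fun x => c * x) (fun x => expR (- x)) _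
    (pinfty_nbhs R)); last exact: cvgr_expR.
  by apply: gt0_cvgMry => //; exact: cvg_id.
- by [].
- apply: cvg_at_right_filter.
  apply: cvgM; first exact: cvg_cst.
  apply: continuous_comp; last exact: continuous_expR.
  apply: continuousN; apply: continuousM; first exact: cst_continuous.
  exact: cvg_id.
- move=> x _. rewrite derive1E derive_val /GRing.scale/=; field.
  exact: lt0r_neq0.
Qed.

(* The integrand of [GammaR a] in the variable [x = ln t], times [dt / dx]. *)
Definition gumbel {R : realType} (a x : R) : R := expR (a * x - expR x).

(** For [x >= 0] the factor [exp (- e^x)] beats every [e^(n x)]; for [x < 0] it is at most 1 and
    [e^(a x)] decays by itself. The rates of decay are 1 on the right and [a] on the left, whence
    the minimum. *)
Lemma gumbel_le {R : realType} (a : R) : 0 < a ->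
  exists c C : R, 0 < c /\ forall x, gumbel a x <= C * expR (- (c * `|x|)).
Proof.
move=> a0.
(* Any integer [n >= a + 1] leaves a spare factor [e^(-x)] once [e^(n x)] has been absorbed. *)
pose n := (Num.truncn (a + 1)).+1.
exists (Num.min a 1), (n`!%:R + 1); split; first by rewrite lt_min a0/=.
move=> x; rewrite /gumbel.
have f0 : 1 <= n`!%:R :> R by rewrite ler1n fact_gt0.
have [x0|x0] := leP 0 x.
- have an : a + 1 <= n%:R by exact/ltW/truncnS_gt.
  have H : expR (n%:R * x) <= n`!%:R * expR (expR x).
    (* One term of the exponential series at [y = e^x]: [y^n / n!] is at most [e^y]. The bound is
       indexed by the predecessor of the exponent. *)
    have := @expR_ge1Dxn R (expR x) n.-1 (expR_ge0 _).
    rewrite prednK// expRM_natl => H.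
    rewrite mulrC -ler_pdivrMr ?(lt_le_trans _ f0)//.
    by apply: le_trans H; rewrite lerDr.
  rewrite ger0_norm// expRB ler_pdivrMr ?expR_gt0//.
  have c1 : expR (- x) <= expR (- (Num.min a 1 * x)).
    by rewrite ler_expR lerN2 ler_piMl// ge_min lexx orbT.
  apply: (@le_trans _ _ ((n`!%:R + 1) * expR (- x) * expR (expR x)));
    last first.
    by rewrite ler_wpM2r ?expR_ge0// ler_wpM2l// addr_ge0// ler0n.
  rewrite mulrAC -ler_pdivrMr ?expR_gt0// -expRB.
  apply: le_trans (le_trans H _); last by rewrite ler_wpM2r ?expR_ge0// lerDl.
  by rewrite ler_expR opprK -{2}[x]mul1r -mulrDl ler_wpM2r.
- rewrite ltr0_norm// mulrN opprK.
  apply: (@le_trans _ _ (1 * expR (Num.min a 1 * x))); last first.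
    by rewrite ler_wpM2r ?expR_ge0// lerDr.
  rewrite mul1r ler_expR.
  apply: (@le_trans _ _ (a * x)); first by rewrite gerBl expR_ge0.
  by rewrite ler_wnM2r ?(ltW x0)// ge_min lexx.
Qed.

Lemma continuous_gumbel {R : realType} (a : R) : continuous (gumbel a).
Proof.
move=> x; apply: continuous_comp; last exact: continuous_expR.
apply: continuousB; last exact: continuous_expR.
by apply: continuousM; [exact: cst_continuous|exact: cvg_id].
Qed.

Lemma integral_gumbel_lty {R : realType} (a : R) : 0 < a ->
  (\int[lebesgue_measure]_x (gumbel a x)%:E < +oo)%E.
Proof.
move=> /(gumbel_le a)[c [C [c0 gC]]].
have cE : continuous (fun x : R => expR (- (c * `|x|))).
  move=> x; apply: continuous_comp; last exact: continuous_expR.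
  apply: continuousN; apply: continuousM; first exact: cst_continuous.
  exact: norm_continuous.
have cCE : continuous (fun x : R => C * expR (- (c * `|x|))).
  by move=> x; apply: cvgM; [exact: cvg_cst|exact: cE].
have C0 : 0 <= C.
  have := le_trans (expR_ge0 _) (gC 0).
  by rewrite pmulr_lge0// expR_gt0.
apply: (@le_lt_trans _ _
  (\int[lebesgue_measure]_x (C * expR (- (c * `|x|)))%:E)%E).
  apply: ge0_le_integral => //.
  - by move=> x _; rewrite lee_fin; exact: expR_ge0.
  - by apply: measurable_EFin_continuous; exact: continuous_gumbel.
  - exact: measurable_EFin_continuous.
  - by move=> x _; rewrite lee_fin.
under eq_integral do rewrite EFinM.
rewrite ge0_integralZl//=.
- by rewrite lte_mul_pinfty ?lee_fin// (integral_expRN_norm_lty c c0).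
- exact: measurable_EFin_continuous.
Qed.

(** Domination by [gumbel a]. The weight [phi] stands for a cosine or a sine, or for the constant 1
    that serves absolute convergence. *)
Lemma integrable_gumbelM {R : realType} (a : R) (phi : R -> R) : 0 < a ->
  continuous phi -> (forall x, `|phi x| <= 1) ->
  lebesgue_measure.-integrable setT (fun x => (gumbel a x * phi x)%:E).
Proof.
move=> a0 cphi phi1.
have cgphi : continuous (fun x => gumbel a x * phi x).
  by move=> x; apply: cvgM; [exact: continuous_gumbel|exact: cphi].
apply/integrableP; split; first exact: measurable_EFin_continuous.
apply: le_lt_trans (integral_gumbel_lty a a0); apply: ge0_le_integral => //.
- by apply: measurableT_comp => //; exact: measurable_EFin_continuous.
- by apply: measurable_EFin_continuous; exact: continuous_gumbel.
- move=> x _; rewrite lee_fin normrM ger0_norm ?expR_ge0//.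
  by rewrite ler_piMr ?expR_ge0.
Qed.

(** * The Bessel function [K_0] as an integral over the line *)

Definition bessel_kernel {R : realType} (x t : R) : R :=
  expR (- (x * ((expR t + expR (- t)) / 2))).

Lemma continuous_bessel_kernel {R : realType} (x : R) :
  continuous (bessel_kernel x).
Proof.
move=> t; apply: continuous_comp; last exact: continuous_expR.
apply: continuousN; apply: cvgM; first exact: cvg_cst.
apply: cvgM; last exact: cvg_cst.
apply: cvgD; first exact: continuous_expR.
apply: continuous_comp; last exact: continuous_expR.
exact: opp_continuous.
Qed.

(** This amounts to [e^t + e^(-t) >= |t|], which follows from [e^t >= 1 + t], [e^(-t) >= 1 - t] and
    positivity. *)
Lemma bessel_kernel_le {R : realType} (x t : R) : 0 < x ->
  bessel_kernel x t <= expR (- (x / 2 * `|t|)).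
Proof.
move=> x0; rewrite ler_expR lerN2 -mulrA ler_pM2l// mulrC ler_pM2r ?invr_gt0//.
have := expR_ge1Dx t; have := expR_ge1Dx (- t).
have := expR_gt0 t; have := expR_gt0 (- t).
by rewrite ler_norml => ? ? ? ?; apply/andP; split; lra.
Qed.

Lemma integral_bessel_kernel_lty {R : realType} (x : R) : 0 < x ->
  (\int[lebesgue_measure]_t (bessel_kernel x t)%:E < +oo)%E.
Proof.
move=> x0; have x20 : 0 < x / 2 by rewrite divr_gt0.
apply: le_lt_trans (integral_expRN_norm_lty _ x20).
apply: ge0_le_integral => //.
- by move=> t _; rewrite lee_fin expR_ge0.
- by apply: measurable_EFin_continuous; exact: continuous_bessel_kernel.
- apply: measurable_EFin_continuous => t.
  apply: continuous_comp; last exact: continuous_expR.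
  apply: continuousN; apply: cvgM; first exact: cvg_cst.
  exact: norm_continuous.
- by move=> t _; rewrite lee_fin bessel_kernel_le.
Qed.

Lemma integrable_bessel_kernel {R : realType} (x : R) : 0 < x ->
  lebesgue_measure.-integrable setT (fun t => (bessel_kernel x t)%:E).
Proof.
move=> x0; apply/integrableP; split.
  by apply: measurable_EFin_continuous; exact: continuous_bessel_kernel.
under eq_integral do rewrite gee0_abs ?lee_fin ?expR_ge0//.
exact: integral_bessel_kernel_lty.
Qed.

Lemma besselK0E {R : realType} (x : R) : 0 < x ->
  ((2 * besselK0 x)%:E = \int[lebesgue_measure]_t (bessel_kernel x t)%:E)%E.
Proof.
move=> x0.
rewrite (ge0_symfun_integralT _ (continuous_bessel_kernel x)); last 2 first.
- by move=> t; exact: expR_ge0.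
- by move=> t; rewrite /bessel_kernel/= opprK addrC.
rewrite EFinM /besselK0 /Rintegral fineK ?set_itvcy//.
rewrite -set_itvcy; apply: integrable_fin_num => //.
by apply: integrableS (integrable_bessel_kernel x x0).
Qed.

(** Continuity under the integral sign on the neighbourhood []x / 2, x + 1[]: the kernel decreases
    in its parameter, so its value at [x / 2] dominates there. *)
Lemma continuous_besselK0 {R : realType} :
  {in `]0, +oo[, continuous (@besselK0 R)}.
Proof.
move=> x; rewrite in_itv/= andbT => x0.
have x20 : 0 < x / 2 by rewrite divr_gt0.
apply: (@continuity_under_integral R _ _ lebesgue_measure bessel_kernel
  _ _ (x / 2) (x + 1) _ _ (bessel_kernel (x / 2))) => //=.
- by move=> y /=; rewrite in_itv/= => /andP[/(lt_trans x20) y0 _];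
    apply: integrableS (integrable_bessel_kernel y y0).
- apply: aeW => t _ y _.
  apply: continuous_comp; last exact: continuous_expR.
  by apply: continuousN; apply: cvgM; [exact: cvg_id|exact: cvg_cst].
- by apply: integrableS (integrable_bessel_kernel _ x20).
- move=> y; rewrite in_itv/= => /andP[xy _]; apply: aeW => t _.
  rewrite ger0_norm ?expR_ge0// ler_expR lerN2; apply: ler_wpM2r (ltW xy).
  by rewrite divr_ge0// addr_ge0// expR_ge0.
- by rewrite inE/= in_itv/= ltr_pdivrMr// ltr_pMr// ltr1n ltrDl ltr01.
Qed.

(** * The double integral and Fubini's theorem *)

(** With [u = e^v] this is [u^a * 2 K_0 (2 sqrt u)], the Mellin integrand of [2 K_0 (2 sqrt u)] with
    respect to [du / u]. *)
Definition bessel_weight {R : realType} (a v : R) : R :=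
  expR (a * v) * (2 * besselK0 (2 * expR (v / 2))).

(** Both sides are iterated integrals of one function of [v = x + y] and [y]. Integrating over [y]
    first produces the Bessel kernel, integrating over [v] first produces a convolution-like product
    of Gamma integrands. A real [phi] allows the real and imaginary parts to be handled by one
    statement. *)
Lemma integral_bessel_weight {R : realType} (a : R) (phi : R -> R) : 0 < a ->
  continuous phi -> (forall x, `|phi x| <= 1) ->
  lebesgue_measure.-integrable setT (fun v => (bessel_weight a v * phi v)%:E) /\
  (\int[lebesgue_measure]_v (bessel_weight a v * phi v)%:E =
   \int[lebesgue_measure]_y (gumbel a y *
     (\int[lebesgue_measure]_x (gumbel a x * phi (x + y)))%R)%:E)%E.
Proof.
move=> a0 cphi phi1.
pose mu : {sigma_finite_measure set (measurableTypeR R) -> \bar R} :=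
  lebesgue_measure.
pose f (z : measurableTypeR R * measurableTypeR R) : \bar R :=
  (gumbel a (z.1 - z.2) * gumbel a z.2 * phi z.1)%:E.
have mgumbel : measurable_fun [set: measurableTypeR R] (gumbel a).
  by apply: continuous_measurable_fun; exact: continuous_gumbel.
have mphi : measurable_fun [set: measurableTypeR R] phi.
  exact: continuous_measurable_fun.
have mf : measurable_fun setT f.
  apply/measurable_EFinP; apply: measurable_funM.
    apply: measurable_funM.
      apply: measurableT_comp; first exact: mgumbel.
      exact: measurable_funB.
    by apply: measurableT_comp; first exact: mgumbel.
  by apply: measurableT_comp; first exact: mphi.
have shiftE (g : R -> R) y : continuous g ->
    (\int[mu]_v (g v)%:E = \int[mu]_x (g (x + y))%:E)%E.
  move=> cg; rewrite (integral_affine 1 y g)//.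
  by apply: eq_integral => x _; rewrite mul1r mulr1.
have FE v : (\int[mu]_y f (v, y) = (bessel_weight a v * phi v)%:E)%E.
  rewrite (shiftE (fun y => gumbel a (v - y) * gumbel a y * phi v) (v / 2)).
    rewrite /bessel_weight mulrAC EFinM besselK0E; last first.
      by rewrite mulr_gt0// expR_gt0.
    rewrite -integralZl//; last first.
      by apply: integrable_bessel_kernel; rewrite mulr_gt0// expR_gt0.
    apply: eq_integral => t _; rewrite -EFinM [in RHS]mulrAC; congr (_ * _)%:E.
    rewrite /gumbel /bessel_kernel -!expRD; congr expR.
    (* At [y = t + v / 2] the two exponentials add up to [e^(v/2) (e^t + e^(-t))], while the linear
       exponents sum to [a v]. *)
    have -> : v - (t + v / 2) = v / 2 + - t by field.
    by rewrite (addrC t) 2!expRD; field.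
  move=> y; apply: cvgM; last exact: cvg_cst.
  apply: cvgM; last exact: continuous_gumbel.
  apply: continuous_comp; last exact: continuous_gumbel.
  by apply: cvgB; [exact: cvg_cst|exact: cvg_id].
(* The weight is left general because the formula serves twice: for [phi], and for the constant 1 in
   the bound on [|f|]. *)
have gintE (psi : R -> R) y : continuous psi -> (forall x, `|psi x| <= 1) ->
    (\int[mu]_v (gumbel a (v - y) * gumbel a y * psi v)%:E = (gumbel a y *
     (\int[lebesgue_measure]_x (gumbel a x * psi (x + y)))%R)%:E)%E.
  move=> cpsi psi1.
  rewrite (shiftE (fun v => gumbel a (v - y) * gumbel a y * psi v) y).
    have int_psi : lebesgue_measure.-integrable setT
        (fun x => (gumbel a x * psi (x + y))%:E).
      apply: (integrable_gumbelM a (fun x => psi (x + y))) => // x.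
      apply: continuous_comp; last exact: cpsi.
      by apply: cvgD; [exact: cvg_id|exact: cvg_cst].
    rewrite EFinM /Rintegral fineK; last exact: integrable_fin_num.
    rewrite -integralZl//; apply: eq_integral => x _.
    by rewrite addrK mulrAC mulrC EFinM.
  move=> v; apply: cvgM; last exact: cpsi.
  apply: cvgM; last exact: cvg_cst.
  apply: continuous_comp; last exact: continuous_gumbel.
  by apply: cvgB; [exact: cvg_id|exact: cvg_cst].
have GE y : (\int[mu]_v f (v, y) = (gumbel a y *
     (\int[lebesgue_measure]_x (gumbel a x * phi (x + y)))%R)%:E)%E.
  exact: gintE.
(* By Tonelli it suffices to integrate [|f|] over [v] and then over [y]. Since [|phi| <= 1], the
   inner integral is at most [gumbel a y * I], which is integrable. *)
have fint : (mu \x mu)%E.-integrable setT f.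
  apply/integrable21ltyP => //.
  pose I := (\int[lebesgue_measure]_x (gumbel a x * 1))%R.
  have cI : continuous (fun y => gumbel a y * I).
    by move=> y; apply: cvgM; [exact: continuous_gumbel|exact: cvg_cst].
  apply: (@le_lt_trans _ _ (\int[mu]_y (gumbel a y * I)%:E)%E).
    apply: ge0_le_integral => //.
    - by move=> y _; apply: integral_ge0 => v _; exact: abse_ge0.
    - apply: (measurable_fun_fubini_tonelli_G (abse \o f)) => //=.
      exact: measurableT_comp.
    - exact: measurable_EFin_continuous.
    - move=> y _; rewrite -(gintE (cst 1))//; last 2 first.
      + exact: cst_continuous.
      + by move=> x; rewrite normr1.
      have cg : continuous (fun v => gumbel a (v - y) * gumbel a y * 1).
        move=> v; apply: cvgM; last exact: cvg_cst.
        apply: cvgM; last exact: cvg_cst.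
        apply: continuous_comp; last exact: continuous_gumbel.
        by apply: cvgB; [exact: cvg_id|exact: cvg_cst].
      apply: ge0_le_integral => //.
      + by apply: measurableT_comp => //; apply: measurableT_comp.
      + exact: measurable_EFin_continuous.
      + move=> v _; rewrite lee_fin normrM ger0_norm ?mulr_ge0 ?expR_ge0//.
        by rewrite ler_wpM2l// mulr_ge0 ?expR_ge0.
  have int1 : lebesgue_measure.-integrable setT (fun y => (gumbel a y * 1)%:E).
    apply: (integrable_gumbelM a (cst 1)) => //; first exact: cst_continuous.
    by move=> x; rewrite normr1.
  have := integrableZr measurableT I int1.
  move=> /(integrable_fin_num measurableT); rewrite fin_numE => /andP[_].
  under eq_integral do rewrite mulr1 -EFinM.
  by rewrite -ltey.
split.
- have := integrable_fubini_F fint.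
  by rewrite /fubini_F; under eq_fun do rewrite FE.
- under eq_integral do rewrite -FE.
  under [RHS]eq_integral do rewrite -GE.
  exact: (Fubini fint).
Qed.

(** * Mellin and Gamma integrals in the logarithmic variable *)

Lemma continuous_powR {R : realType} (p : R) :
  {in `]0, +oo[, continuous (@powR R ^~ p)}.
Proof.
move=> x x0; apply/differentiable_continuous/derivable1_diffP.
exact: derivable_powR.
Qed.

(** Under [z = e^x] the phase of [z^(s-1)] becomes [Im s * x], and the Jacobian turns the modulus
    [z^(Re s - 1)] into [e^(Re s * x)]. *)
Lemma cint0oo_mellin {R : realType} (s : R[i]) (g : R -> R) :
  {in `]0, +oo[, continuous g} ->
  cint0oo (fun z => cpowR z (s - 1) * (g z)%:C) =
  (\int[lebesgue_measure]_x
     (expR (complex.Re s * x) * g (expR x) * cos (complex.Im s * x)))%R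
  +i* (\int[lebesgue_measure]_x
     (expR (complex.Re s * x) * g (expR x) * sin (complex.Im s * x)))%R.
Proof.
move=> cg.
have trigE (u : R -> R) : continuous u ->
    (\int[lebesgue_measure]_(z in `]0%R, +oo[)
      (z `^ (complex.Re s - 1) * u (complex.Im s * ln z) * g z))%R =
    (\int[lebesgue_measure]_x
      (expR (complex.Re s * x) * g (expR x) * u (complex.Im s * x)))%R.
  move=> cu; rewrite /Rintegral integral_expR; last first.
    move=> z z0; apply: cvgM; last exact: cg.
    move: z0; rewrite in_itv/= andbT => z0.
    apply: cvgM.
      by apply: continuous_powR; rewrite in_itv/= andbT.
    apply: continuous_comp; last exact: cu.
    by apply: cvgM; [exact: cvg_cst|exact: continuous_ln].
  congr fine; apply: eq_integral => x _; congr EFin.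
  have -> : expR (complex.Re s * x) = expR x `^ (complex.Re s - 1) * expR x.
    by rewrite -expRM -expRD; congr expR; ring.
  by rewrite expRK; ring.
rewrite /cint0oo -(trigE cos)//; last exact: continuous_cos.
rewrite -(trigE sin)//; last exact: continuous_sin.
by congr (_ +i* _); apply: eq_Rintegral => z _; move: {trigE} s => [a b];
  rewrite /cpowR/= ?subr0; ring.
Qed.

Lemma GammaC_gumbel {R : realType} (w : R[i]) :
  GammaC w =
  (\int[lebesgue_measure]_x
     (gumbel (complex.Re w) x * cos (complex.Im w * x)))%R
  +i* (\int[lebesgue_measure]_x
     (gumbel (complex.Re w) x * sin (complex.Im w * x)))%R.
Proof.
rewrite /GammaC cint0oo_mellin; last first.
  move=> z _; apply: continuous_comp; last exact: continuous_expR.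
  exact: opp_continuous.
by congr (_ +i* _); apply: eq_Rintegral => x _; rewrite -expRD.
Qed.

(** In the variable [ln t] the integrand is at least [e^(-e)] on [[0, 1]]. Finiteness matters as
    well, since [fine] sends [+oo] to 0. *)
Lemma GammaR_gt0 {R : realType} (x : R) : 0 < x -> 0 < GammaR x.
Proof.
move=> x0; rewrite /GammaR /Rintegral integral_expR; last first.
  move=> z z0; apply: cvgM; first exact: continuous_powR.
  apply: continuous_comp; last exact: continuous_expR.
  exact: opp_continuous.
have -> : (\int[lebesgue_measure]_y
      (expR y `^ (x - 1) * expR (- expR y) * expR y)%:E =
    \int[lebesgue_measure]_y (gumbel x y)%:E)%E.
  apply: eq_integral => y _; rewrite -expRM -!expRD; congr (expR _)%:E; ring.
apply: fine_gt0; rewrite integral_gumbel_lty// andbT.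
apply: (@lt_le_trans _ _
  (\int[lebesgue_measure]_(y in `[0%R, 1%R]) (expR (- expR 1))%:E)%E).
  rewrite integral_cst//= lebesgue_measure_itv/= lte_fin ltr01 -EFinB -EFinM.
  by rewrite lte_fin subr0 mulr1 expR_gt0.
apply: (@le_trans _ _
  (\int[lebesgue_measure]_(y in `[0%R, 1%R]) (gumbel x y)%:E)%E).
  apply: ge0_le_integral => //.
  - apply: measurable_funTS; apply: measurable_EFin_continuous.
    exact: continuous_gumbel.
  - move=> y /=; rewrite in_itv/= => /andP[y0 y1].
    rewrite lee_fin ler_expR.
    have := mulr_ge0 (ltW x0) y0; have : expR y <= expR 1 by rewrite ler_expR.
    lra.
apply: ge0_subset_integral => //.
- apply: measurable_EFin_continuous.
  exact: continuous_gumbel.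
- by move=> y _; rewrite lee_fin expR_ge0.
Qed.

(** * The square of the complex Gamma function *)

Lemma Rintegral_lincomb {d} {T : measurableType d} {R : realType}
    (mu : {measure set T -> \bar R}) (p q : R) (f g : T -> R) :
  mu.-integrable setT (EFin \o f) -> mu.-integrable setT (EFin \o g) ->
  (\int[mu]_x (p * f x + q * g x) =
   p * (\int[mu]_x f x) + q * (\int[mu]_x g x))%R.
Proof.
move=> fi gi; rewrite RintegralD//; last 2 first.
- exact: (integrableZl measurableT p fi).
- exact: (integrableZl measurableT q gi).
by rewrite !RintegralZl.
Qed.

Lemma continuous_scale_comp {R : realType} (b : R) (u : R -> R) :
  continuous u -> continuous (fun x => u (b * x)).
Proof.
move=> cu x; apply: continuous_comp; last exact: cu.
by apply: cvgM; [exact: cvg_cst|exact: cvg_id].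
Qed.

Lemma norm_sin_le1 {R : realType} (x : R) : `|sin x| <= 1.
Proof. by rewrite ler_norml sin_geN1 sin_le1. Qed.

Lemma norm_cos_le1 {R : realType} (x : R) : `|cos x| <= 1.
Proof. by rewrite ler_norml cos_geN1 cos_le1. Qed.

Lemma continuous_bessel_weight {R : realType} (a : R) :
  continuous (bessel_weight a).
Proof.
have cK : continuous (fun v : R => besselK0 (2 * expR (v / 2))).
  move=> v; apply: (@continuous_comp R R R (fun v : R => 2 * expR (v / 2))
    (@besselK0 R)); last first.
    by apply: continuous_besselK0; rewrite in_itv/= andbT mulr_gt0// expR_gt0.
  apply: cvgM; first exact: cvg_cst.
  apply: continuous_comp; last exact: continuous_expR.
  by apply: cvgM; [exact: cvg_id|exact: cvg_cst].
have cE : continuous (fun v => expR (a * v)).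
  by apply: (continuous_scale_comp a expR); exact: continuous_expR.
move=> v; apply: cvgM; first exact: cE.
by apply: cvgM; [exact: cvg_cst|exact: cK].
Qed.

(** Let [C] and [S] be the cosine and sine integrals of [gumbel]. The addition formulas for
    [cos (b (x + y))] and [sin (b (x + y))] separate the double integrals into [C^2 - S^2] and
    [2 S C], the two parts of [(C + i S)^2]. *)
Lemma GammaC_sqr {R : realType} (w : R[i]) : 0 < complex.Re w ->
  GammaC w ^+ 2 =
  (\int[lebesgue_measure]_v
     (bessel_weight (complex.Re w) v * cos (complex.Im w * v)))%R
  +i* (\int[lebesgue_measure]_v
     (bessel_weight (complex.Re w) v * sin (complex.Im w * v)))%R.
Proof.
move: (complex.Re w) (complex.Im w) (GammaC_gumbel w) => a b -> a0.
have ccos : continuous (fun x : R => cos (b * x)).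
  by apply: continuous_scale_comp; exact: continuous_cos.
have csin : continuous (fun x : R => sin (b * x)).
  by apply: continuous_scale_comp; exact: continuous_sin.
have [_ cosE] := integral_bessel_weight a _ a0 ccos (fun=> norm_cos_le1 _).
have [_ sinE] := integral_bessel_weight a _ a0 csin (fun=> norm_sin_le1 _).
have icos := integrable_gumbelM a _ a0 ccos (fun=> norm_cos_le1 _).
have isin := integrable_gumbelM a _ a0 csin (fun=> norm_sin_le1 _).
rewrite [in RHS]/Rintegral cosE sinE.
set C := (\int[lebesgue_measure]_x (gumbel a x * cos (b * x)))%R.
set S := (\int[lebesgue_measure]_x (gumbel a x * sin (b * x)))%R.
have cos2 : (\int[lebesgue_measure]_y (gumbel a y *
    (\int[lebesgue_measure]_x (gumbel a x * cos (b * (x + y)))))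
    = C ^+ 2 - S ^+ 2)%R.
  rewrite expr2 (expr2 S) -mulNr -Rintegral_lincomb//.
  apply: eq_Rintegral => y _.
  have -> : (\int[lebesgue_measure]_x (gumbel a x * cos (b * (x + y))) =
             cos (b * y) * C + - sin (b * y) * S)%R.
    rewrite -Rintegral_lincomb//.
    by apply: eq_Rintegral => x _; rewrite mulrDr cosD; ring.
  ring.
have sin2 : (\int[lebesgue_measure]_y (gumbel a y *
    (\int[lebesgue_measure]_x (gumbel a x * sin (b * (x + y)))))
    = S * C + C * S)%R.
  rewrite -Rintegral_lincomb//.
  apply: eq_Rintegral => y _.
  have -> : (\int[lebesgue_measure]_x (gumbel a x * sin (b * (x + y))) =
             cos (b * y) * S + sin (b * y) * C)%R.
    rewrite -Rintegral_lincomb//.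
    by apply: eq_Rintegral => x _; rewrite mulrDr sinD; ring.
  ring.
rewrite /Rintegral in cos2 sin2; rewrite cos2 sin2.
by apply/eqP; rewrite eq_complex /=; apply/andP; split; apply/eqP; ring.
Qed.

(** * The density [f_Z] in the logarithmic variable *)

Lemma GND_Lambda_gt0 {R : realType} (sigma alpha : R) :
  0 < sigma -> 0 < alpha -> 0 < GND_Lambda sigma alpha.
Proof.
move=> s0 a0; rewrite mulr_gt0 ?invr_gt0// sqrtr_gt0 divr_gt0// GammaR_gt0//.
all: by rewrite divr_gt0.
Qed.

Lemma continuous_fZ {R : realType} (sigma alpha : R) :
  0 < sigma -> 0 < alpha -> {in `]0, +oo[, continuous (fZ sigma alpha)}.
Proof.
move=> s0 a0 z; rewrite in_itv/= andbT => z0.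
have L0 := GND_Lambda_gt0 _ _ s0 a0.
apply: cvgM; first exact: cvg_cst.
apply: (@continuous_comp R R R
  (fun z : R => 2 * GND_Lambda sigma alpha `^ alpha * `|z| `^ (alpha / 2))
  (@besselK0 R)).
  apply: cvgM; first exact: cvg_cst.
  apply: (@continuous_comp R R R Num.norm (@powR R ^~ (alpha / 2))).
    exact: norm_continuous.
  by apply: continuous_powR; rewrite in_itv/= andbT normr_gt0 gt_eqF.
apply: continuous_besselK0.
by rewrite in_itv/= andbT !mulr_gt0 ?powR_gt0// normr_gt0 gt_eqF.
Qed.

(** The point [v = alpha x + 2 alpha ln L] is the one for which [2 e^(v/2)] equals the argument
    [2 L^alpha z^(alpha/2)] of [K_0] at [z = e^x]. Then [e^(r v / alpha) = e^(r x) L^(2 r)], so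
    [L^2] leaves [L^(2 - 2 r)]. The last factor [alpha] is the Jacobian [dv / dx]. *)
Lemma fZ_expR {R : realType} (sigma alpha r x : R) : 0 < sigma -> 0 < alpha ->
  let L := GND_Lambda sigma alpha in
  expR (r * x) * (2 * fZ sigma alpha (expR x)) =
  L `^ (2 - 2 * r) / GammaR (1 / alpha) ^+ 2
  * bessel_weight (r / alpha) (alpha * x + 2 * alpha * ln L) * alpha.
Proof.
move=> s0 a0 L; have L0 : 0 < L := GND_Lambda_gt0 _ _ s0 a0.
have G0 : GammaR (1 / alpha) != 0 by rewrite gt_eqF// GammaR_gt0// divr_gt0.
rewrite /fZ -/L /bessel_weight ger0_norm ?expR_ge0//.
have -> : 2 * expR ((alpha * x + 2 * alpha * ln L) / 2) =
          2 * L `^ alpha * expR x `^ (alpha / 2).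
  rewrite -[L in L `^ _]lnK ?posrE// -!expRM -[RHS]mulrA -expRD.
  congr (_ * expR _).
  by field.
have -> : expR (r / alpha * (alpha * x + 2 * alpha * ln L)) =
          expR (r * x) * L `^ (2 * r).
  rewrite -[L in RHS]lnK ?posrE// -expRM -expRD; congr expR.
  by field; rewrite gt_eqF.
have -> : L ^+ 2 = L `^ (2 - 2 * r) * L `^ (2 * r).
  by rewrite -powRD ?subrK ?powR_mulrn ?(ltW L0)// gt_eqF// implybT.
by field.
Qed.

(** The argument of [u] on the right is [x] expressed through [v = alpha x + 2 alpha ln L]. *)
Lemma integral_fZ_expR {R : realType} (sigma alpha r : R) (u : R -> R) :
  0 < sigma -> 0 < alpha -> continuous u ->
  let L := GND_Lambda sigma alpha in
  (\int[lebesgue_measure]_x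
     (expR (r * x) * (2 * fZ sigma alpha (expR x)) * u x)%:E =
   \int[lebesgue_measure]_v (L `^ (2 - 2 * r) / GammaR (1 / alpha) ^+ 2
    * (bessel_weight (r / alpha) v * u (v / alpha - 2 * ln L)))%:E)%E.
Proof.
move=> s0 a0 cu L; rewrite [RHS](integral_affine alpha (2 * alpha * ln L))//.
  apply: eq_integral => x _; rewrite (fZ_expR _ _ _ _ s0 a0) -/L.
  have -> : (alpha * x + 2 * alpha * ln L) / alpha - 2 * ln L = x.
    by field; rewrite gt_eqF.
  by congr EFin; ring.
move=> v; apply: cvgM; first exact: cvg_cst.
apply: cvgM; first exact: continuous_bessel_weight.
apply: (@continuous_comp R R R (fun v => v / alpha - 2 * ln L) u);
  last exact: cu.
apply: cvgB; last exact: cvg_cst.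
by apply: cvgM; [exact: cvg_id|exact: cvg_cst].
Qed.

(** * Absolute convergence and value of the Mellin transform *)

(** [cint0oo] takes a value even for divergent integrals, so the first conjunct certifies
    convergence: [z^(Re s - 1)] is the modulus of [z^(s-1)]. *)
Theorem theorem6 (R : realType) (sigma alpha : R) (s : R[i]) :
  0 < sigma -> 0 < alpha -> 0 < complex.Re s ->
  let L := GND_Lambda sigma alpha in
  lebesgue_measure.-integrable `]0, +oo[
    (fun z : R => (z `^ (complex.Re s - 1) * (2 * fZ sigma alpha z))%:E) /\
  cint0oo (fun z : R => cpowR z (s - 1) * (2 * fZ sigma alpha z)%:C)
  = cpowR L (2 - 2 * s) * GammaC (s / alpha%:C) ^+ 2
    / ((GammaR (1 / alpha)) ^+ 2)%:C.
Proof.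
move=> s0 a0 r0 L.
have L0 : 0 < L := GND_Lambda_gt0 _ _ s0 a0.
have cf : {in `]0, +oo[, continuous (fun z => 2 * fZ sigma alpha z)}.
  by move=> z z0; apply: cvgM; [exact: cvg_cst|exact: continuous_fZ].
have ra0 : 0 < complex.Re s / alpha by rewrite divr_gt0.
pose K := L `^ (2 - 2 * complex.Re s) / GammaR (1 / alpha) ^+ 2.
pose W := bessel_weight (complex.Re s / alpha).
have intW (u : R -> R) : continuous u -> (forall x, `|u x| <= 1) ->
    lebesgue_measure.-integrable setT (fun v => (W v * u v)%:E).
  by move=> cu u1; have [] := integral_bessel_weight _ _ ra0 cu u1.
split.
  have cz : {in `]0, +oo[, continuous
      (fun z : R => z `^ (complex.Re s - 1) * (2 * fZ sigma alpha z))}.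
    by move=> z z0; apply: cvgM; [exact: continuous_powR|exact: cf].
  apply/integrableP; split.
    apply/measurable_EFinP; apply: open_continuous_measurable_fun.
      exact: interval_open.
    by move=> z /[1!inE]; exact: cz.
  have -> : (\int[lebesgue_measure]_(z in `]0%R, +oo[)
      `|(z `^ (complex.Re s - 1) * (2 * fZ sigma alpha z))%:E| =
      \int[lebesgue_measure]_v `|(K * (W v * 1))%:E|)%E.
    rewrite (integral_expR (fun z : R =>
      `|z `^ (complex.Re s - 1) * (2 * fZ sigma alpha z)|)); last first.
      move=> z z0; apply: (@continuous_comp R R R
        (fun z : R => z `^ (complex.Re s - 1) * (2 * fZ sigma alpha z))
        Num.norm).
        exact: cz.
      exact: norm_continuous.
    rewrite [RHS](integral_affine alpha (2 * alpha * ln L)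
      (fun v => `|K * (W v * 1)|))//; last first.
      move=> v; apply: (@continuous_comp R R R (fun v => K * (W v * 1))
        Num.norm).
        apply: cvgM; first exact: cvg_cst.
        by apply: cvgM; [exact: continuous_bessel_weight|exact: cvg_cst].
      exact: norm_continuous.
    apply: eq_integral => x _; congr EFin.
    (* The Jacobians [e^x] and [alpha] are moved inside the absolute values, so that [fZ_expR]
       identifies their contents. *)
    rewrite -[X in _ * X](ger0_norm (expR_ge0 x)).
    rewrite -[X in _ = _ * X](ger0_norm (ltW a0)).
    rewrite -!normrM mulr1 /K /W -(fZ_expR _ _ _ _ s0 a0); congr `|_|.
    rewrite mulrAC -expRM -expRD; congr (expR _ * _); ring.
  have i1 : lebesgue_measure.-integrable setT (fun v => (W v * 1)%:E).
    apply: (intW (cst 1)); first exact: cst_continuous.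
    by move=> x; rewrite normr1.
  by have /integrableP[] := integrableZl measurableT K i1.
rewrite cint0oo_mellin//.
have -> : s / alpha%:C = (complex.Re s / alpha) +i* (complex.Im s / alpha).
  rewrite -fmorphV; clear; case: s => a b /=; simpc.
  by rewrite /=.
rewrite GammaC_sqr//=.
(* [theta] is minus the phase of [L^(2 - 2 s)]. It appears because [t x = (t / alpha) v - theta]
   when [x = v / alpha - 2 ln L]. *)
set t := complex.Im s; pose theta := 2 * t * ln L.
have ccos : continuous (fun v : R => cos (t / alpha * v)).
  by apply: continuous_scale_comp; exact: continuous_cos.
have csin : continuous (fun v : R => sin (t / alpha * v)).
  by apply: continuous_scale_comp; exact: continuous_sin.
have icos := intW _ ccos (fun=> norm_cos_le1 _).
have isin := intW _ csin (fun=> norm_sin_le1 _).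
set A := (\int[lebesgue_measure]_v (_ * cos (t / alpha * v)))%R.
set B := (\int[lebesgue_measure]_v (_ * sin (t / alpha * v)))%R.
(* This is the real part of [K e^(- i theta) (A + i B)], where [A + i B] is the square of the Gamma
   value; the sine integral below is its imaginary part. *)
have -> : (\int[lebesgue_measure]_x (expR (complex.Re s * x)
    * (2 * fZ sigma alpha (expR x)) * cos (t * x)))%R
    = K * cos theta * A + K * sin theta * B.
  rewrite -Rintegral_lincomb// /Rintegral.
  rewrite (integral_fZ_expR _ _ _ (fun x => cos (t * x)))//; last first.
    by apply: continuous_scale_comp; exact: continuous_cos.
  congr fine; apply: eq_integral => v _; rewrite -/L -/K -/W.
  have -> : t * (v / alpha - 2 * ln L) = t / alpha * v - theta.
    by rewrite /theta; ring.
  by rewrite cosB; congr EFin; ring.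
have -> : (\int[lebesgue_measure]_x (expR (complex.Re s * x)
    * (2 * fZ sigma alpha (expR x)) * sin (t * x)))%R
    = K * cos theta * B + - (K * sin theta) * A.
  rewrite -Rintegral_lincomb// /Rintegral.
  rewrite (integral_fZ_expR _ _ _ (fun x => sin (t * x)))//; last first.
    by apply: continuous_scale_comp; exact: continuous_sin.
  congr fine; apply: eq_integral => v _; rewrite -/L -/K -/W.
  have -> : t * (v / alpha - 2 * ln L) = t / alpha * v - theta.
    by rewrite /theta; ring.
  by rewrite sinB; congr EFin; ring.
have -> : cpowR L (2 - 2 * s) =
  (L `^ (2 - 2 * complex.Re s))%:C * (cos theta +i* (- sin theta)).
  rewrite /cpowR /theta -sinN -cosN /t; clear; case: s => a b.
  have -> : 2 - 2 * (a +i* b) = (2 - 2 * a) +i* (- (2 * b)).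
    by apply/eqP; rewrite eq_complex/=; apply/andP; split; apply/eqP; ring.
  by rewrite /= mulNr ?opprK.
have -> (x : R) : (x%:C)^-1 = (x^-1)%:C by rewrite fmorphV.
rewrite /K.
by apply/eqP; rewrite eq_complex/=; apply/andP; split; apply/eqP; ring.
Qed.
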